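(* Suppose that $A\in\mathbb{DC}^{n\times n}$ is Hermitian. Then $A$ has exactly $n$ eigenvalues (counted with multiplicity), which are all dual numbers. There are also $n$ eigenvectors, associated with these $n$ eigenvalues. The Hermitian matrix $A$ is positive semidefinite if and only if all of these eigenvalues are nonnegative, and $A$ is positive definite if and only if all of these eigenvalues are positive and appreciable.
   Context: Let $\epsilon\neq 0$ be the infinitesimal unit, $\epsilon^2=0$, commuting with complex numbers. Dual complex numbers: $\mathbb{DC}=\{q=q_{st}+q_{\mathcal I}\epsilon : q_{st},q_{\mathcal I}\in\mathbb C\}$ (a commutative ring); dual numbers: $\mathbb D=\{q_{st}+q_{\mathcal I}\epsilon: q_{st},q_{\mathcal I}\in\mathbb R\}$. A number is appreciable if $q_{st}\neq0$. The conjugate of $q$ is $\bar q=\bar q_{st}+\bar q_{\mathcal I}\epsilon$, and for a matrix $A=(a_{ij})$ (or column vector) over $\mathbb{DC}$, $A^*=(\bar a_{ji})$. $\mathbb D$ is totally ordered: $p\le q$ iff $p_{st}<q_{st}$, or $p_{st}=q_{st}$ and $p_{\mathcal I}\le q_{\mathcal I}$; $q$ is nonnegative if $q\ge0$ and positive if $q>0$. A square matrix $A\in\mathbb{DC}^{n\times n}$ is Hermitian if $A^*=A$. A vector in $\mathbb{DC}^n$ is appreciable if at least one component is appreciable. $\lambda\in\mathbb{DC}$ is an eigenvalue of $A$ with eigenvector $\mathbf x\in\mathbb{DC}^n$ if $\mathbf x$ is appreciable and $A\mathbf x=\lambda\mathbf x$. Multiplicities are counted as in the unitary diagonalization: there is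 a unitary $U$ (that is, $U^*U=I_n$) with $U^*AU$ diagonal with entries in $\mathbb D$, this diagonal matrix being unique up to ordering of its diagonal entries, and the $n$ eigenvalues are its diagonal entries. For Hermitian $A$ and any $\mathbf x\in\mathbb{DC}^n$, $\mathbf x^*A\mathbf x\in\mathbb D$; $A$ is positive semidefinite if $\mathbf x^*A\mathbf x\ge0$ for all $\mathbf x\in\mathbb{DC}^n$, and positive definite if $\mathbf x^*A\mathbf x$ is positive and appreciable for all appreciable $\mathbf x\in\mathbb{DC}^n$. *)

(* Defs.v *)
From HB Require Import structures.
From mathcomp Require Import all_boot all_order all_algebra all_fingroup.
From mathcomp Require Import reals.
From mathcomp Require Export complex.

Set Implicit Arguments.
Unset Strict Implicit.
Unset Printing Implicit Defensive.

Import Order.TTheory GRing.Theory Num.Theory.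
Local Open Scope ring_scope.

(* [Dual a b] is a + b * e, where e is the infinitesimal unit, e ^ 2 = 0. *)
Record dual (K : Type) := Dual { st : K; eps : K }.

Lemma dual_eq (K : Type) (p q : dual K) :
  st p = st q -> eps p = eps q -> p = q.
Proof. by case: p q => [? ?] [? ?] /= -> ->. Qed.

Definition dual_pair (K : Type) (q : dual K) : K * K := (st q, eps q).
Definition pair_dual (K : Type) (p : K * K) : dual K := Dual p.1 p.2.

Lemma dual_pairK (K : Type) : cancel (@dual_pair K) (@pair_dual K).
Proof. by case. Qed.

HB.instance Definition _ (K : eqType) :=
  Equality.copy (dual K) (can_type (@dual_pairK K)).
HB.instance Definition _ (K : choiceType) :=
  Choice.copy (dual K) (can_type (@dual_pairK K)).

Section DualZmodule.
Variable K : zmodType.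
Implicit Types p q r : dual K.

Definition dual_zero : dual K := Dual 0 0.
Definition dual_opp q : dual K := Dual (- st q) (- eps q).
Definition dual_add p q : dual K := Dual (st p + st q) (eps p + eps q).

Fact dual_addA : associative dual_add.
Proof. by move=> p q r; apply: dual_eq; rewrite /= addrA. Qed.
Fact dual_addC : commutative dual_add.
Proof. by move=> p q; apply: dual_eq; rewrite /= addrC. Qed.
Fact dual_add0 : left_id dual_zero dual_add.
Proof. by move=> p; apply: dual_eq; rewrite /= add0r. Qed.
Fact dual_addN : left_inverse dual_zero dual_opp dual_add.
Proof. by move=> p; apply: dual_eq; rewrite /= addNr. Qed.

HB.instance Definition _ := GRing.isZmodule.Build (dual K)
  dual_addA dual_addC dual_add0 dual_addN.

End DualZmodule.

Section DualRing.
Variable K : comNzRingType.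
Implicit Types p q r : dual K.

Definition dual_one : dual K := Dual 1 0.
Definition dual_mul p q : dual K :=
  Dual (st p * st q) (st p * eps q + eps p * st q).

Fact dual_mulA : associative dual_mul.
Proof.
by move=> p q r; apply: dual_eq; rewrite /= ?mulrDr ?mulrDl !mulrA ?addrA.
Qed.
Fact dual_mulC : commutative dual_mul.
Proof.
move=> p q; apply: dual_eq; first exact: mulrC.
by rewrite /= addrC [eps p * _]mulrC [st p * _]mulrC.
Qed.
Fact dual_mul1 : left_id dual_one dual_mul.
Proof. by move=> p; apply: dual_eq; rewrite /= mul1r // mul0r addr0. Qed.
Fact dual_mulDl : left_distributive dual_mul +%R.
Proof.
by move=> p q r; apply: dual_eq; rewrite /= !mulrDl // addrACA.
Qed.
Fact dual_one_neq0 : dual_one != 0.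
Proof. by apply/eqP => -[] /eqP; rewrite oner_eq0. Qed.

HB.instance Definition _ := GRing.Zmodule_isComNzRing.Build (dual K)
  dual_mulA dual_mulC dual_mul1 dual_mulDl dual_one_neq0.

Definition appreciable q : bool := st q != 0.

End DualRing.

Section DualOrder.
Variable K : realDomainType.
Implicit Types p q r : dual K.

Definition dual_le p q : bool :=
  (st p < st q) || (st p == st q) && (eps p <= eps q).

Fact dual_le_refl : reflexive dual_le.
Proof. by move=> p; rewrite /dual_le eqxx lexx orbT. Qed.
Fact dual_le_anti : antisymmetric dual_le.
Proof.
move=> p q; rewrite /dual_le; case: (ltgtP (st p) (st q)) => //= e.
by move/le_anti; apply: dual_eq.
Qed.
Fact dual_le_trans : transitive dual_le.
Proof.
move=> q p r /orP[pq|/andP[/eqP pq pq']] /orP[qr|/andP[/eqP qr qr']].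
- by rewrite /dual_le (lt_trans pq qr).
- by rewrite /dual_le -qr pq.
- by rewrite /dual_le pq qr.
- by rewrite /dual_le pq qr eqxx (le_trans pq' qr') orbT.
Qed.
Fact dual_le_total : total dual_le.
Proof.
move=> p q; rewrite /dual_le.
by case: (ltgtP (st p) (st q)) => //= _; apply: le_total.
Qed.

HB.instance Definition _ := Order.Le_isPOrder.Build ring_display (dual K)
  dual_le_refl dual_le_anti dual_le_trans.
HB.instance Definition _ := Order.POrder_isTotal.Build ring_display (dual K)
  dual_le_total.

End DualOrder.

Notation D R := (dual (Real.sort R)).
Notation DC R := (dual (complex (Real.sort R))).

Definition toDC (R : realType) (d : D R) : DC R :=
  Dual (st d)%:C%C (eps d)%:C%C.

Definition dconj (R : realType) (q : DC R) : DC R :=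
  Dual (st q)^*%C (eps q)^*%C.

Definition adjmx (R : realType) (m n : nat) (A : 'M[DC R]_(m, n)) :
  'M[DC R]_(n, m) := (map_mx (@dconj R) A)^T.

Definition dc_hermitian (R : realType) (n : nat) (A : 'M[DC R]_n) : Prop :=
  adjmx A = A.

Definition dc_unitary (R : realType) (n : nat) (U : 'M[DC R]_n) : Prop :=
  adjmx U *m U = 1%:M.

Definition appreciable_vec (R : realType) (n : nat) (x : 'cV[DC R]_n) : Prop :=
  exists i : 'I_n, appreciable (x i 0).

Definition dc_eigenvector (R : realType) (n : nat) (A : 'M[DC R]_n)
    (lambda : DC R) (x : 'cV[DC R]_n) : Prop :=
  appreciable_vec x /\ A *m x = lambda *: x.

Definition dc_eigenvalue (R : realType) (n : nat) (A : 'M[DC R]_n)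
    (lambda : DC R) : Prop :=
  exists x : 'cV[DC R]_n, dc_eigenvector A lambda x.

Definition dc_diagonalizes (R : realType) (n : nat) (U A : 'M[DC R]_n)
    (lambda : 'rV[DC R]_n) : Prop :=
  dc_unitary U /\ adjmx U *m A *m U = diag_mx lambda.

Definition qform (R : realType) (n : nat) (A : 'M[DC R]_n)
    (x : 'cV[DC R]_n) : DC R := (adjmx x *m A *m x) 0 0.

(* The order lives on D only, so [qform A x] is compared with 0 through the
   dual number it equals; for Hermitian A there always is one, by
   [qform_hermitian] below. *)
Definition dc_psd (R : realType) (n : nat) (A : 'M[DC R]_n) : Prop :=
  forall x : 'cV[DC R]_n, exists2 d : D R, qform A x = toDC d & 0 <= d.

Definition dc_pd (R : realType) (n : nat) (A : 'M[DC R]_n) : Prop :=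
  forall x : 'cV[DC R]_n, appreciable_vec x ->
  exists2 d : D R, qform A x = toDC d & 0 < d /\ appreciable d.

Lemma dconj_is_zmod_morphism (R : realType) : zmod_morphism (@dconj R).
Proof. by move=> p q; apply: dual_eq; rewrite /= rmorphB. Qed.

Lemma dconj_is_monoid_morphism (R : realType) : monoid_morphism (@dconj R).
Proof.
split=> [|p q]; apply: dual_eq.
- exact: conjc1.
- exact: conjc0.
- by rewrite /= rmorphM.
- by rewrite /= rmorphD !rmorphM.
Qed.

HB.instance Definition _ (R : realType) :=
  GRing.isZmodMorphism.Build (DC R) (DC R) (@dconj R)
    (@dconj_is_zmod_morphism R).
HB.instance Definition _ (R : realType) :=
  GRing.isMonoidMorphism.Build (DC R) (DC R) (@dconj R)
    (@dconj_is_monoid_morphism R).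

Lemma adjmxK (R : realType) (m n : nat) (A : 'M[DC R]_(m, n)) :
  adjmx (adjmx A) = A.
Proof.
by apply/matrixP => i j; rewrite !mxE; apply: dual_eq; rewrite /= conjcK.
Qed.

Lemma adjmxM (R : realType) (m n p : nat)
    (A : 'M[DC R]_(m, n)) (B : 'M[DC R]_(n, p)) :
  adjmx (A *m B) = adjmx B *m adjmx A.
Proof. by rewrite /adjmx map_mxM trmx_mul. Qed.

Lemma qform_hermitian (R : realType) (n : nat) (A : 'M[DC R]_n)
    (x : 'cV[DC R]_n) :
  dc_hermitian A -> exists d : D R, qform A x = toDC d.
Proof.
move=> hA; have hX : adjmx (adjmx x *m A *m x) = adjmx x *m A *m x.
  by rewrite !adjmxM adjmxK hA mulmxA.
have: dconj (qform A x) = qform A x.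
  by rewrite /qform -[in RHS]hX [RHS]mxE [RHS]mxE.
have re (z : R[i]) : z^*%C = z -> z = (complex.Re z)%:C%C.
  by case: z => a b [] /eqP; rewrite eqNr => /eqP->.
case: (qform A x) => a b hq.
exists (Dual (complex.Re a) (complex.Re b)).
apply: dual_eq; apply: re.
- exact: (congr1 (fun q : DC R => st q) hq).
- exact: (congr1 (fun q : DC R => eps q) hq).
Qed.

(* Main.v *)
From HB Require Import structures.
Require Import Defs.
From mathcomp Require Import all_boot all_order all_algebra all_fingroup.
From mathcomp Require Import spectral sesquilinear reals ring.

(** Write [A = A0 + A1 e] with [A0] and [A1] Hermitian complex matrices. A
    complex unitary change of basis makes [A0] a real diagonal matrix [d].
    Conjugating by a unitary [1 + S e], with [S] skew-Hermitian, keeps [d] and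
    adds the commutator [d S - S d] to the infinitesimal part, whose [(i, j)]
    entry is [(d i - d j) * S i j]; hence [S] can be chosen to cancel every
    infinitesimal entry with [d i <> d j], and what remains commutes with [d]
    ([hermitian_dual_diag_commute]). Two commuting Hermitian complex matrices
    are simultaneously diagonalized by a unitary matrix
    ([hermitian_codiagonalizable]), so that [A] is unitarily similar to a
    diagonal matrix, whose entries are dual numbers because it is Hermitian
    ([hermitian_diagonalizable]).

    Factorization over the dual complex numbers is not unique, so uniqueness of
    the diagonal does not come from the characteristic polynomial. Two
    diagonalizations are intertwined by an invertible matrix [W], that is
    [lambda i * W i j = W i j * mu j]; the determinant of the standard part of
    [W] is nonzero, so for some permutation [s] all the entries [W i (s i)] are
    appreciable, and these can be cancelled ([intertwined_diag_perm]).
    Cancelling an appreciable coordinate also identifies the eigenvalues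
    ([diagonalizes_eigenvalue]).

    Finally, (semi)definiteness is invariant under unitary similarity, and on a
    diagonal matrix the quadratic form is the sum of the [lambda i * |x i|^2],
    where [|x i|^2] is a nonnegative dual number ([dc_psd_diag],
    [dc_pd_diag]). *)

Set Implicit Arguments.
Unset Strict Implicit.
Unset Printing Implicit Defensive.

Import Order.TTheory GRing.Theory Num.Theory.
Local Open Scope ring_scope.
Local Open Scope sesquilinear_scope.

(** * Commuting Hermitian complex matrices *)

Lemma hermitian_trig_diag (C : numClosedFieldType) (n : nat) (M : 'M[C]_n) :
  M ^t* = M -> is_trig_mx M -> is_diag_mx M.
Proof.
move=> hM /is_trig_mxP tM; apply/is_diag_mxP => i j.
case: (ltngtP i j) => // [ij|ji] _; first exact: tM.
by rewrite -hM !mxE tM // rmorph0.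
Qed.

(** A unitary matrix that makes both [H] and [K] triangular makes them diagonal,
    since it keeps them Hermitian. *)
Lemma hermitian_codiagonalizable (C : numClosedFieldType) (n : nat)
    (H K : 'M[C]_n) :
  H ^t* = H -> K ^t* = K -> H *m K = K *m H ->
  exists2 P : 'M[C]_n, P^t* *m P = 1%:M &
    is_diag_mx (P^t* *m H *m P) /\ is_diag_mx (P^t* *m K *m P).
Proof.
move=> hH hK /cotrigonalization2[Q uQ /andP[]].
have hconj (M : 'M[C]_n) : M ^t* = M -> (Q *m M *m Q ^t*) ^t* = Q *m M *m Q ^t*.
  by move=> hM; rewrite !trmx_mul !map_mxM trmxCK hM mulmxA.
rewrite /similar_to !conjymx // => tH tK; exists (Q ^t*).
  by rewrite trmxCK; apply/unitarymxP.
by rewrite trmxCK; split; apply: hermitian_trig_diag => //; apply: hconj.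
Qed.

(** * Dual numbers *)

Lemma st_is_zmod_morphism (K : comNzRingType) : zmod_morphism (@st K).
Proof. by []. Qed.
Lemma st_is_monoid_morphism (K : comNzRingType) : monoid_morphism (@st K).
Proof. by []. Qed.
HB.instance Definition _ (K : comNzRingType) :=
  GRing.isZmodMorphism.Build (dual K) K (@st K) (@st_is_zmod_morphism K).
HB.instance Definition _ (K : comNzRingType) :=
  GRing.isMonoidMorphism.Build (dual K) K (@st K) (@st_is_monoid_morphism K).

Lemma eps_is_zmod_morphism (K : comNzRingType) : zmod_morphism (@eps K).
Proof. by []. Qed.
HB.instance Definition _ (K : comNzRingType) :=
  GRing.isZmodMorphism.Build (dual K) K (@eps K) (@eps_is_zmod_morphism K).

Lemma toDC_is_zmod_morphism (R : realType) : zmod_morphism (@toDC R).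
Proof. by move=> p q; apply: dual_eq; rewrite /= rmorphB. Qed.
Lemma toDC_is_monoid_morphism (R : realType) : monoid_morphism (@toDC R).
Proof.
by split=> [|p q]; apply: dual_eq; rewrite //= ?rmorphD !rmorphM.
Qed.
HB.instance Definition _ (R : realType) :=
  GRing.isZmodMorphism.Build (D R) (DC R) (@toDC R) (@toDC_is_zmod_morphism R).
HB.instance Definition _ (R : realType) :=
  GRing.isMonoidMorphism.Build (D R) (DC R) (@toDC R)
    (@toDC_is_monoid_morphism R).

Lemma toDC_inj (R : realType) : injective (@toDC R).
Proof. by move=> [a b] [c d] [] /= -> ->. Qed.

Lemma dconj_fixed (R : realType) (q : DC R) :
  dconj q = q -> exists d : D R, q = toDC d.
Proof.
have re (z : R[i]) : z^*%C = z -> z = (complex.Re z)%:C%C.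
  by case: z => a b [] /eqP; rewrite eqNr => /eqP->.
case: q => a b [/re ha /re hb].
by exists (Dual (complex.Re a) (complex.Re b)); rewrite /toDC /= -ha -hb.
Qed.

Lemma appreciable_mulfI (K : idomainType) (w : dual K) :
  appreciable w -> injective ( *%R w).
Proof.
move=> w0 p q [/(mulfI w0) hst]; rewrite hst => /addIr /(mulfI w0).
exact: dual_eq.
Qed.

Lemma dual_ge0 (K : realDomainType) (p : dual K) :
  (0 <= p) = (0 < st p) || (st p == 0) && (0 <= eps p).
Proof. by rewrite -[LHS]/(dual_le 0 p) /dual_le /= [0 == _]eq_sym. Qed.

(** The positive appreciable dual numbers are those with a positive standard
    part. *)
Lemma dual_gt0_appreciable (K : realDomainType) (p : dual K) :
  0 < p /\ appreciable p <-> 0 < st p.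
Proof.
split=> [[/ltW]|p0].
  rewrite dual_ge0 /appreciable => /orP[//|/andP[/eqP-> _]].
  by rewrite eqxx.
split; last by rewrite /appreciable gt_eqF.
rewrite lt_def dual_ge0 p0 andbT; apply: contraTneq p0 => ->.
by rewrite ltxx.
Qed.

Lemma dual_addr_ge0 (K : realDomainType) (p q : dual K) :
  0 <= p -> 0 <= q -> 0 <= p + q.
Proof.
rewrite !dual_ge0 /= => /orP[p0|/andP[/eqP-> p1]] /orP[q0|/andP[/eqP-> q1]].
- by rewrite addr_gt0.
- by rewrite addr0 p0.
- by rewrite add0r q0.
- by rewrite addr0 eqxx addr_ge0 ?orbT.
Qed.

Lemma dual_mulr_ge0 (K : realDomainType) (p q : dual K) :
  0 <= p -> 0 <= q -> 0 <= p * q.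
Proof.
rewrite !dual_ge0 /= => /orP[p0|/andP[/eqP-> p1]] /orP[q0|/andP[/eqP-> q1]].
- by rewrite mulr_gt0.
- by rewrite !mulr0 addr0 eqxx mulr_ge0 ?orbT // ltW.
- by rewrite !mul0r add0r eqxx mulr_ge0 ?orbT // ltW.
- by rewrite !mulr0 mul0r addr0 eqxx lexx orbT.
Qed.

Section DualMatrices.
Variable R : realType.
Implicit Types m n p : nat.

(** * Standard and infinitesimal parts of a matrix *)

(** The matrix [A0 + A1 e] with standard part [A0] and infinitesimal part
    [A1]. *)
Definition dualmx m n (A0 A1 : 'M[R[i]]_(m, n)) : 'M[DC R]_(m, n) :=
  \matrix_(i, j) Dual (A0 i j) (A1 i j).

Lemma dualmxE m n (A : 'M[DC R]_(m, n)) :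
  A = dualmx (map_mx (@st _) A) (map_mx (@eps _) A).
Proof. by apply/matrixP => i j; rewrite !mxE; case: (A i j). Qed.

Lemma dualmxM m n p (A0 A1 : 'M_(m, n)) (B0 B1 : 'M_(n, p)) :
  dualmx A0 A1 *m dualmx B0 B1 = dualmx (A0 *m B0) (A0 *m B1 + A1 *m B0).
Proof.
apply/matrixP => i j; rewrite !mxE; apply: dual_eq.
  by rewrite raddf_sum; apply: eq_bigr => k _; rewrite !mxE.
by rewrite raddf_sum -big_split; apply: eq_bigr => k _; rewrite !mxE.
Qed.

Lemma adjmx_dualmx m n (A0 A1 : 'M_(m, n)) :
  adjmx (dualmx A0 A1) = dualmx (A0 ^t*) (A1 ^t*).
Proof. by apply/matrixP => i j; rewrite !mxE. Qed.

Lemma dualmx1 n : dualmx (1%:M : 'M_n) 0 = 1%:M.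
Proof.
by apply/matrixP => i j; rewrite !mxE; case: eqP.
Qed.

Lemma dualmx_inj m n (A0 A1 B0 B1 : 'M_(m, n)) :
  dualmx A0 A1 = dualmx B0 B1 -> A0 = B0 /\ A1 = B1.
Proof.
by move=> /matrixP e; split; apply/matrixP => i j; move: (e i j);
  rewrite !mxE => -[].
Qed.

(** * Diagonalization of Hermitian matrices *)

(** [B = U^* A U] for some unitary [U]. *)
Definition unitarily_similar n (A B : 'M[DC R]_n) : Prop :=
  exists2 U : 'M[DC R]_n, dc_unitary U & adjmx U *m A *m U = B.

Lemma unitarily_similar_trans n (A B C : 'M[DC R]_n) :
  unitarily_similar A B -> unitarily_similar B C -> unitarily_similar A C.
Proof.
move=> [U hU <-] [V hV <-]; exists (U *m V); last first.
  by rewrite adjmxM; move: (adjmx U) (adjmx V) => U' V'; rewrite !mulmxA.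
by rewrite /dc_unitary adjmxM mulmxA -(mulmxA _ _ U) hU mulmx1 hV.
Qed.

Lemma unitarily_similar_hermitian n (A B : 'M[DC R]_n) :
  unitarily_similar A B -> dc_hermitian A -> dc_hermitian B.
Proof.
by move=> [U _ <-] hA; rewrite /dc_hermitian !adjmxM adjmxK hA mulmxA.
Qed.

Lemma standard_unitary_similar n (A0 A1 P : 'M_n) : P^t* *m P = 1%:M ->
  unitarily_similar (dualmx A0 A1)
    (dualmx (P^t* *m A0 *m P) (P^t* *m A1 *m P)).
Proof.
move=> hP; have z : (0 : 'M[R[i]]_n) ^t* = 0 by rewrite trmx0 map_mx0.
exists (dualmx P 0).
  by rewrite /dc_unitary adjmx_dualmx dualmxM z mulmx0 mul0mx addr0 hP dualmx1.
by rewrite adjmx_dualmx !dualmxM z mulmx0 mul0mx add0r addr0.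
Qed.

(** The similarity is given by [1 + S e], which is unitary because [S] is
    skew-Hermitian. *)
Lemma infinitesimal_unitary_similar n (A0 A1 S : 'M_n) : S^t* = - S ->
  unitarily_similar (dualmx A0 A1) (dualmx A0 (A1 + (A0 *m S - S *m A0))).
Proof.
move=> hS; have o : (1%:M : 'M[R[i]]_n) ^t* = 1%:M by rewrite trmx1 map_mx1.
exists (dualmx 1%:M S).
  by rewrite /dc_unitary adjmx_dualmx dualmxM o hS !mul1mx mulmx1 subrr dualmx1.
rewrite adjmx_dualmx !dualmxM o hS !mul1mx !mulmx1 mulNmx.
by rewrite addrCA.
Qed.

(** Off the eigenspaces of its standard part, the infinitesimal part of a
    Hermitian matrix can be removed by a unitary similarity. *)
Lemma hermitian_dual_diag_commute n (d : 'rV_n) (B : 'M_n) :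
  dc_hermitian (dualmx (diag_mx d) B) ->
  exists2 C : 'M_n, unitarily_similar (dualmx (diag_mx d) B)
                      (dualmx (diag_mx d) C)
    & diag_mx d *m C = C *m diag_mx d.
Proof.
rewrite /dc_hermitian adjmx_dualmx => /dualmx_inj[hd hB].
have dr i : (d 0 i)^* = d 0 i.
  by move/matrixP/(_ i i): hd; rewrite !mxE eqxx.
have Br i j : (B i j)^* = B j i by move/matrixP/(_ j i): hB; rewrite !mxE.
(* Where d i = d j the quotient is 0, as x / 0 = 0, and B i j is kept. *)
pose S := \matrix_(i, j) (B i j / (d 0 j - d 0 i)) : 'M[R[i]]_n.
have hS : S ^t* = - S.
  apply/matrixP => i j; rewrite !mxE rmorphM fmorphV rmorphB /= !dr Br.
  by rewrite -mulrN -invrN opprB.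
exists (B + (diag_mx d *m S - S *m diag_mx d)).
  exact: infinitesimal_unitary_similar.
set C := B + _; apply/matrixP => i j.
rewrite mul_diag_mx mul_mx_diag [LHS]mxE [RHS]mxE.
have [->|dij] := eqVneq (d 0 i) (d 0 j); first exact: mulrC.
suff -> : C i j = 0 by rewrite mulr0 mul0r.
rewrite /C mul_diag_mx mul_mx_diag !mxE [d 0 i * _]mulrC -mulrBr.
by rewrite -[d 0 i - d 0 j]opprB mulrN divfK ?subrr // subr_eq0 eq_sym.
Qed.

Lemma hermitian_dual_diag_real n (d e : 'rV_n) :
  dc_hermitian (dualmx (diag_mx d) (diag_mx e)) ->
  exists lambda : 'rV[D R]_n,
    dualmx (diag_mx d) (diag_mx e) = diag_mx (map_mx (@toDC R) lambda).
Proof.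
move=> /matrixP h.
have real i : exists l : D R, Dual (d 0 i) (e 0 i) = toDC l.
  apply: dconj_fixed; move: (h i i).
  by rewrite !mxE eqxx !mulr1n.
have [l hl] := fin_all_exists real; exists (\row_i l i).
apply/matrixP => i j; rewrite !mxE; case: eqP => // _.
by rewrite !mulr1n hl.
Qed.

Lemma hermitian_diagonalizable n (A : 'M[DC R]_n) : dc_hermitian A ->
  exists lambda : 'rV[D R]_n,
    unitarily_similar A (diag_mx (map_mx (@toDC R) lambda)).
Proof.
move=> hA; rewrite (dualmxE A) in hA *.
set A0 := map_mx _ _ in hA *; set A1 := map_mx _ _ in hA *.
have [hA0 _] : A0 ^t* = A0 /\ A1 ^t* = A1.
  by apply: dualmx_inj; rewrite -adjmx_dualmx.
have [P uP [/diag_mxP[d dP] _]] := hermitian_codiagonalizable hA0 hA0 erefl.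
have := standard_unitary_similar A0 A1 uP; rewrite dP => simB.
have hB := unitarily_similar_hermitian simB hA.
have [C simC commC] := hermitian_dual_diag_commute hB.
have hC := unitarily_similar_hermitian simC hB.
have [hD hC1] : (diag_mx d) ^t* = diag_mx d /\ C ^t* = C.
  by apply: dualmx_inj; rewrite -adjmx_dualmx.
have [Q uQ [/diag_mxP[d' d'P] /diag_mxP[e eP]]] :=
  hermitian_codiagonalizable hD hC1 commC.
have := standard_unitary_similar (diag_mx d) C uQ; rewrite d'P eP => simE.
have hE := unitarily_similar_hermitian simE hC.
have [l lE] := hermitian_dual_diag_real hE; exists l; rewrite -lE.
exact: unitarily_similar_trans simB (unitarily_similar_trans simC simE).
Qed.

(** * Eigenvectors, eigenvalues and uniqueness of the diagonal *)

Lemma appreciable_vecP n (x : 'cV[DC R]_n) :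
  appreciable_vec x <-> map_mx (@st _) x != 0.
Proof.
split=> [[i xi]|x0].
  by apply: contraNneq xi => /matrixP/(_ i 0); rewrite !mxE => /eqP.
by have /cV0Pn[k] := x0; rewrite mxE; exists k.
Qed.

Lemma appreciable_vec_mulmx m n (B : 'M[DC R]_(m, n)) (x : 'cV_n) :
  appreciable_vec (B *m x) -> appreciable_vec x.
Proof.
rewrite !appreciable_vecP map_mxM; apply: contra_neq => ->.
exact: mulmx0.
Qed.

Lemma dc_unitaryC n (U : 'M[DC R]_n) : dc_unitary U -> U *m adjmx U = 1%:M.
Proof. exact: mulmx1C. Qed.

Lemma unitary_col_appreciable n (U : 'M[DC R]_n) (i : 'I_n) :
  dc_unitary U -> appreciable_vec (col i U).
Proof.
move=> hU; apply: (@appreciable_vec_mulmx _ _ (adjmx U)).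
by exists i; rewrite colE mulmxA hU mul1mx mxE !eqxx; apply: oner_neq0.
Qed.

Lemma diagonalizes_mulmx n (U A : 'M[DC R]_n) mu :
  dc_diagonalizes U A mu -> A *m U = U *m diag_mx mu.
Proof. by case=> hU <-; rewrite -(mulmxA _ A) mulmxA dc_unitaryC // mul1mx. Qed.

Lemma diagonalizes_eigenvector n (U A : 'M[DC R]_n) mu (i : 'I_n) :
  dc_diagonalizes U A mu -> dc_eigenvector A (mu 0 i) (col i U).
Proof.
move=> hUA; split; first exact: unitary_col_appreciable hUA.1.
rewrite !colE mulmxA (diagonalizes_mulmx hUA) -mulmxA scalemxAr.
congr (U *m _); apply/matrixP => k j.
rewrite mul_diag_mx [LHS]mxE [RHS]mxE [delta_mx _ _ _ _]mxE.
by case: eqP => [->|_] //; rewrite andFb !mulr0.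
Qed.

(** The determinant expansion of the standard part of [W] has a nonzero term:
    along its permutation the entries of [W] can be cancelled. *)
Lemma intertwined_diag_perm n (W : 'M[DC R]_n) (lambda mu : 'rV[DC R]_n) :
  \det (map_mx (@st _) W) != 0 -> diag_mx lambda *m W = W *m diag_mx mu ->
  exists s : 'S_n, mu = col_perm s lambda.
Proof.
move=> detW /matrixP eW.
have [s Ws] : exists s : 'S_n, forall i, appreciable (W i (s i)).
  suff /existsP[s /forallP] :
      [exists s : 'S_n, [forall i, appreciable (W i (s i))]] by exists s.
  apply: contraNT detW => /existsPn noW; rewrite /determinant big1 // => s _.
  have /forallPn[k] := noW s; rewrite negbK => /eqP Wk0.
  by rewrite (bigD1 k) //= mxE Wk0 mul0r mulr0.
exists (s^-1)%g; apply/rowP => j; rewrite mxE.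
apply/esym/(appreciable_mulfI (Ws (s^-1%g j))); rewrite permKV mulrC.
by move: (eW (s^-1%g j) j); rewrite mul_diag_mx mul_mx_diag !mxE.
Qed.

Lemma diagonalization_unique n (U V A : 'M[DC R]_n) (lambda mu : 'rV[DC R]_n) :
  dc_diagonalizes U A lambda -> dc_diagonalizes V A mu ->
  exists s : 'S_n, mu = col_perm s lambda.
Proof.
move=> hU hV; apply: (@intertwined_diag_perm _ (adjmx U *m V)).
  have [[uU _] [uV _]] := (hU, hV); rewrite -unitfE -unitmxE map_mxM.
  rewrite unitmx_mul; apply/andP; split.
    apply: (proj1 (mulmx1_unit (B := map_mx (@st _) U) _)).
    by rewrite -map_mxM uU map_mx1.
  apply: (proj2 (mulmx1_unit (A := map_mx (@st _) (adjmx V)) _)).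
  by rewrite -map_mxM uV map_mx1.
rewrite -mulmxA -(diagonalizes_mulmx hV) -hU.2 -(mulmxA _ U).
by rewrite (mulmxA U) dc_unitaryC ?mul1mx ?mulmxA //; case: hU.
Qed.

Lemma diagonalizes_eigenvalue n (U A : 'M[DC R]_n) lambda (mu : DC R) :
  dc_diagonalizes U A lambda -> dc_eigenvalue A mu -> exists i, mu = lambda 0 i.
Proof.
move=> [hU hD] [x [appx Ax]].
have Ux : U *m (adjmx U *m x) = x by rewrite mulmxA dc_unitaryC // mul1mx.
have [i yi] : appreciable_vec (adjmx U *m x).
  by apply: (@appreciable_vec_mulmx _ _ U); rewrite Ux.
exists i; apply/(appreciable_mulfI yi).
have /matrixP/(_ i 0) : diag_mx lambda *m (adjmx U *m x) = mu *: (adjmx U *m x).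
  by rewrite -hD -(mulmxA _ U) Ux -mulmxA Ax scalemxAr.
by rewrite mul_diag_mx !mxE [mu * _]mulrC [lambda 0 i * _]mulrC => ->.
Qed.

(** * Positivity *)

(** The squared modulus of a dual complex number: for [q = a + b e], this is
    [|a|^2 + 2 Re (conj a * b) e]. It is defined by its real coordinates so as to
    be a dual number. *)
Definition dnormsq (q : DC R) : D R :=
  Dual (complex.Re (st q) ^+ 2 + complex.Im (st q) ^+ 2)
    ((complex.Re (st q) * complex.Re (eps q)
       + complex.Im (st q) * complex.Im (eps q)) *+ 2).

Lemma dnormsqE q : toDC (dnormsq q) = dconj q * q.
Proof.
case: q => -[a b] [c d]; apply: dual_eq => /=; simpc; congr (_ +i* _)%C; ring.
Qed.

Lemma st_dnormsq_gt0 q : (0 < st (dnormsq q)) = appreciable q.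
Proof.
case: q => -[a b] c /=; rewrite /appreciable /= eq_complex /= negb_and.
rewrite lt_def addr_ge0 ?sqr_ge0 // andbT paddr_eq0 ?sqr_ge0 //.
by rewrite !sqrf_eq0 negb_and.
Qed.

(** When the standard part of [q] vanishes, so does [dnormsq q]. *)
Lemma dnormsq_ge0 q : 0 <= dnormsq q.
Proof.
have := st_dnormsq_gt0 q; rewrite dual_ge0; case: ltP => //= _ /esym.
case: q => -[a b] [c d] /negbFE/eqP[-> ->] /=.
by rewrite !mul0r expr0n /= !addr0 mul0rn eqxx lexx.
Qed.

Lemma qform_mulmx n (A U : 'M[DC R]_n) (y : 'cV_n) :
  qform A (U *m y) = qform (adjmx U *m A *m U) y.
Proof.
rewrite /qform adjmxM; move: (adjmx U) (adjmx y) => U' y'.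
by rewrite !mulmxA.
Qed.

Lemma qform_diag n (lambda : 'rV[D R]_n) (y : 'cV_n) :
  qform (diag_mx (map_mx (@toDC R) lambda)) y =
    toDC (\sum_i lambda 0 i * dnormsq (y i 0)).
Proof.
rewrite /qform -mulmxA mul_diag_mx mxE rmorph_sum /=; apply: eq_bigr => i _.
by rewrite !mxE rmorphM /= dnormsqE mulrCA.
Qed.

Lemma qform_diag_delta n (lambda : 'rV[D R]_n) (i : 'I_n) :
  qform (diag_mx (map_mx (@toDC R) lambda)) (delta_mx i 0) = toDC (lambda 0 i).
Proof.
rewrite /qform -mulmxA -colE; rewrite mxE (bigD1 i) //= big1 ?addr0.
  by rewrite !mxE !eqxx /= rmorph1 mul1r.
by move=> j /negPf ji; rewrite !mxE ji /= rmorph0 mul0r.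
Qed.

Lemma dc_psd_similar n (A B : 'M[DC R]_n) :
  unitarily_similar A B -> dc_psd A -> dc_psd B.
Proof. by move=> [U _ <-] hA y; rewrite -qform_mulmx; apply: hA. Qed.

Lemma dc_pd_similar n (A B : 'M[DC R]_n) :
  unitarily_similar A B -> dc_pd A -> dc_pd B.
Proof.
move=> [U uU <-] hA y appy; rewrite -qform_mulmx; apply: hA.
by apply: (@appreciable_vec_mulmx _ _ (adjmx U)); rewrite mulmxA uU mul1mx.
Qed.

Lemma unitarily_similar_sym n (A B : 'M[DC R]_n) :
  unitarily_similar A B -> unitarily_similar B A.
Proof.
move=> [U uU <-]; have uU' := dc_unitaryC uU; exists (adjmx U).
  by rewrite /dc_unitary adjmxK.
rewrite adjmxK; move: (adjmx U) uU' => U' uU'.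
by rewrite !mulmxA uU' mul1mx -mulmxA uU' mulmx1.
Qed.

Lemma dc_psd_diag n (lambda : 'rV[D R]_n) :
  dc_psd (diag_mx (map_mx (@toDC R) lambda)) <-> forall i, 0 <= lambda 0 i.
Proof.
split=> [h i|h y].
  by have [d] := h (delta_mx i 0); rewrite qform_diag_delta => /toDC_inj->.
rewrite qform_diag; eexists; first reflexivity.
elim/big_ind: _ => [|p q p0 q0|i _]; first exact: lexx.
  exact: dual_addr_ge0.
by rewrite dual_mulr_ge0 ?dnormsq_ge0.
Qed.

Lemma dc_pd_diag n (lambda : 'rV[D R]_n) :
  dc_pd (diag_mx (map_mx (@toDC R) lambda)) <->
  forall i, 0 < lambda 0 i /\ appreciable (lambda 0 i).
Proof.
split=> [h i|h y [i yi]].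
  have [|d] := h (delta_mx i 0); last first.
    by rewrite qform_diag_delta => /toDC_inj->.
  by exists i; rewrite mxE !eqxx; apply: oner_neq0.
rewrite qform_diag; eexists; first reflexivity.
have l0 k : 0 < st (lambda 0 k) by apply/dual_gt0_appreciable.
apply/dual_gt0_appreciable; rewrite raddf_sum (bigD1 i) //=.
rewrite ltr_wpDr ?mulr_gt0 ?st_dnormsq_gt0 // sumr_ge0 // => k _.
by rewrite mulr_ge0 ?(ltW (l0 k)) //= addr_ge0 ?sqr_ge0.
Qed.
End DualMatrices.

Theorem theorem4p5 (R : realType) (n : nat) (A : 'M[DC R]_n) (hA : dc_hermitian A) :
  exists lambda : 'rV[D R]_n,
    [/\ (exists2 U : 'M[DC R]_n,
           dc_diagonalizes U A (map_mx (@toDC R) lambda)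
           & forall i : 'I_n, dc_eigenvector A (toDC (lambda 0 i)) (col i U)),
        (forall (V : 'M[DC R]_n) (mu : 'rV[DC R]_n), dc_diagonalizes V A mu ->
           exists s : 'S_n, mu = col_perm s (map_mx (@toDC R) lambda)),
        (forall mu : DC R,
           dc_eigenvalue A mu <-> exists i : 'I_n, mu = toDC (lambda 0 i)),
        (dc_psd A <-> forall i : 'I_n, 0 <= lambda 0 i)
      & (dc_pd A <-> forall i : 'I_n, 0 < lambda 0 i /\ appreciable (lambda 0 i))].
Proof.
have [l simA] := hermitian_diagonalizable hA; exists l.
have simA' := unitarily_similar_sym simA.
have [U uU UA] := simA.
have hU : dc_diagonalizes U A (map_mx (@toDC R) l) by [].
have hE i : dc_eigenvector A (toDC (l 0 i)) (col i U).
  by have := diagonalizes_eigenvector i hU; rewrite mxE.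
split.
- by exists U.
- by move=> V mu; apply: diagonalization_unique hU.
- move=> mu; split=> [muA|[k ->]]; last by exists (col k U).
  have [k ->] := diagonalizes_eigenvalue hU muA.
  by exists k; rewrite mxE.
- rewrite -dc_psd_diag; split; exact: dc_psd_similar.
- rewrite -dc_pd_diag; split; exact: dc_pd_similar.
Qed.
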